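(* Let $F:\mathbb{R}^m\times\mathbb{R}^m\to\mathbb{R}$ be a continuously Fréchet differentiable function, let $(x_n)_{n\in\mathbb{N}}\subseteq\mathbb{R}^m$ and $x_{-1}\in\mathbb{R}^m$, let $(\alpha_n)_{n\in\mathbb{N}},(\beta_n)_{n\in\mathbb{N}}$ be bounded real sequences, and for $n\in\mathbb{N}$ let $$z_n=\big(x_n+\alpha_n(x_n-x_{n-1}),\,x_n+\beta_n(x_n-x_{n-1})\big).$$ Assume that there are constants $a,b>0$ such that: (H1) for each $n\in\mathbb{N}$, $a\|x_{n+1}-x_n\|^2\le F(z_n)-F(z_{n+1})$; (H2) for each $n\in\mathbb{N}$, $n\ge1$, $\|\nabla F(z_n)\|\le b(\|x_{n+1}-x_n\|+\|x_n-x_{n-1}\|)$. Moreover, assume that the set $\omega((z_n)_{n\in\mathbb{N}})$ of cluster points of $(z_n)_{n\in\mathbb{N}}$ is nonempty and that $F$ has the Kurdyka-Łojasiewicz property at a point $z^*=(x^*,x^* )\in\omega((z_n)_{n\in\mathbb{N}})$. Then the sequence $(x_n)_{n\in\mathbb{N}}$ converges to $x^*$, $(z_n)_{n\in\mathbb{N}}$ converges to $z^*$, and $\nabla F(z^* )=0$.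
   Context: $\mathbb{N}=\{0,1,2,\dots\}$; $\|\cdot\|$ is the Euclidean norm ($\mathbb{R}^m\times\mathbb{R}^m$ carries the Euclidean norm of $\mathbb{R}^{2m}$). A cluster point of a sequence is the limit of one of its subsequences. Kurdyka-Łojasiewicz (KL) property. For $\eta\in(0,+\infty]$, $\Theta_\eta$ denotes the class of concave and continuous functions $\varphi:[0,\eta)\to[0,+\infty)$ such that $\varphi(0)=0$, $\varphi$ is continuously differentiable on $(0,\eta)$, continuous at $0$, and $\varphi'(t)>0$ for all $t\in(0,\eta)$. A differentiable function $f:\mathbb{R}^d\to\mathbb{R}$ satisfies the KL property at $\overline{x}\in\mathbb{R}^d$ if there exist $\eta\in(0,+\infty]$, a neighborhood $U$ of $\overline{x}$ and $\varphi\in\Theta_\eta$ such that for all $x\in U\cap\{x\in\mathbb{R}^d: f(\overline{x})<f(x)<f(\overline{x})+\eta\}$ one has $\varphi'(f(x)-f(\overline{x}))\|\nabla f(x)\|\ge 1$. *)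

(* Defs.v *)
From mathcomp Require Export all_boot all_order all_algebra.
From mathcomp Require Export all_classical all_reals all_analysis.

Set Implicit Arguments.
Unset Strict Implicit.
Unset Printing Implicit Defensive.
Export Order.TTheory GRing.Theory Num.Theory.
Export numFieldNormedType.Exports.

Local Open Scope classical_set_scope.
Local Open Scope ring_scope.

(* The library norm `|v| on 'rV[R]_d is the sup norm, so the Euclidean norm is
   defined here.  The two norms are equivalent: the library's topology (limits,
   neighborhoods, continuity) and its Frechet differentiability on 'rV[R]_d are
   the Euclidean ones. *)
Definition enorm (R : realType) (d : nat) (v : 'rV[R]_d) : R :=
  Num.sqrt (\sum_(i < d) v 0 i ^+ 2).

(* The vector representing the Frechet derivative 'd f x in the standard inner
   product; meaningful when f is differentiable at x. *)
Definition gradient (R : realType) (d : nat) (f : 'rV[R]_d -> R)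
    (x : 'rV[R]_d) : 'rV[R]_d :=
  \row_(i < d) 'd f x (delta_mx 0 i).

Definition continuously_differentiable (R : realType) (d : nat)
    (f : 'rV[R]_d -> R) : Prop :=
  (forall x, differentiable f x) /\ continuous (gradient f).

(* A function [0, eta) -> [0, +oo) is encoded as a total
   function on R whose values outside [0, eta) are irrelevant; continuity at 0
   is relative to [0, eta), hence one-sided.  phi is concave iff - phi is
   convex. *)
Definition Theta (R : realType) (eta : \bar R) (phi : R -> R) : Prop :=
  let D := [set t : R | 0 <= t /\ (t%:E < eta)%E] in
  let D0 := [set t : R | 0 < t /\ (t%:E < eta)%E] in
  [/\ (forall t, D t -> 0 <= phi t),
      convex_function (D : set R) (fun t => - phi t),
      {within D, continuous phi},
      phi 0 = 0 &
      [/\ (forall t, D0 t -> derivable phi t 1),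
          {within D0, continuous (derive1 phi)} &
          (forall t, D0 t -> 0 < derive1 phi t)]].

Definition KL_property (R : realType) (d : nat) (f : 'rV[R]_d -> R)
    (xbar : 'rV[R]_d) : Prop :=
  exists (eta : \bar R) (U : set 'rV[R]_d) (phi : R -> R),
    [/\ (0 < eta)%E, nbhs xbar U, Theta eta phi &
      forall x, U x -> f xbar < f x -> ((f x)%:E < (f xbar)%:E + eta)%E ->
        1 <= derive1 phi (f x - f xbar) * enorm (gradient f x)].

(* omega(u): limits of subsequences, which is not the library's filter-based
   [cluster]. *)
Definition cluster_points (R : realType) (d : nat) (u : nat -> 'rV[R]_d) :
    set 'rV[R]_d :=
  [set l | exists k : nat -> nat,
     {homo k : i j / (i < j)%N} /\ (fun n => u (k n)) @ \oo --> l].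

Definition previous (T : Type) (xm1 : T) (x : nat -> T) (n : nat) : T :=
  if n is k.+1 then x k else xm1.

(* R^m x R^m is represented as R^(m + m), the pair (u, v) being row_mx u v; thus
   [enorm] on it is the Euclidean norm of R^(2m).  xm1 stands for x_{-1}. *)
Definition zseq (R : realType) (m : nat) (xm1 : 'rV[R]_m)
    (x : nat -> 'rV[R]_m) (alpha beta : nat -> R) (n : nat) : 'rV[R]_(m + m) :=
  row_mx (x n + alpha n *: (x n - previous xm1 x n))
         (x n + beta n *: (x n - previous xm1 x n)).

(* Main.v *)
(* Write d_n = ||x_n - x_{n-1}|| and r_n = F(z_n) - F(xs, xs), which decreases to
   0; d_n tends to 0 by (H1).  When z_n lies in the KL neighborhood, concavity
   of phi, (H1) and (H2) give
     a d_{n+1}^2 <= b (phi(r_n) - phi(r_{n+1})) (d_n + d_{n+1}),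
   whence d_{n+1} <= T_n - T_{n+1} with T_n = d_n + C phi(r_n).  Then
   ||xs - x_n|| + T_n is nonincreasing as long as x_n stays near xs; it tends to
   0 along the given subsequence, so once it is small at some index the sequence
   stays trapped, for every radius.  This yields x_n -> xs without first
   proving that (x_n) is Cauchy. *)
Require Import Defs.
From mathcomp Require Import ring lra.

Set Implicit Arguments.
Unset Strict Implicit.
Unset Printing Implicit Defensive.

Local Open Scope classical_set_scope.
Local Open Scope ring_scope.

(** * Sup norm against Euclidean norm *)

Lemma entry_le_norm (R : realType) m n (M : 'M[R]_(m, n)) i j : `|M i j| <= `|M|.
Proof.
rewrite -/(mx_norm M) mx_normrE.
exact: (le_bigmax _ (fun ij => `|M ij.1 ij.2|) (i, j)).
Qed.

Lemma norm_le_entries (R : realType) m n (M : 'M[R]_(m, n)) (r : R) :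
  0 <= r -> (forall i j, `|M i j| <= r) -> `|M| <= r.
Proof.
by move=> r0 Mr; rewrite -/(mx_norm M) mx_normrE; apply: bigmax_le => // i _.
Qed.

Lemma norm_le_enorm (R : realType) d (v : 'rV[R]_d) : `|v| <= enorm v.
Proof.
apply: norm_le_entries => [|i j]; first exact: sqrtr_ge0.
rewrite (ord1 i) -sqrtr_sqr ler_wsqrtr// (bigD1 j)//= lerDl.
by apply: sumr_ge0 => k _; exact: sqr_ge0.
Qed.

Lemma norm_row_mx_le (R : realType) m (u v : 'rV[R]_m) (r : R) :
  `|u| <= r -> `|v| <= r -> `|row_mx u v| <= r.
Proof.
move=> ur vr; apply: norm_le_entries => [|i j].
  by rewrite (le_trans _ ur).
by rewrite mxE; case: splitP => k _; apply: (le_trans (entry_le_norm _ _ _)).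
Qed.

Lemma norm_lsubmx_le (R : realType) m (w : 'rV[R]_(m + m)) :
  `|lsubmx w| <= `|w|.
Proof. by apply: norm_le_entries => // i j; rewrite mxE entry_le_norm. Qed.

(** * The one-step estimate from concavity and the KL inequality *)

Lemma concave_le_tangent (R : realType) (D : set R) (phi : R -> R) (s t : R) :
  convex_function (D : set R) (fun u => - phi u) -> D s -> D t ->
  derivable phi s 1 -> phi t <= phi s + derive1 phi s * (t - s).
Proof.
move=> cvxD Ds Dt /derivable1_diffP dphi.
have dts : derivable phi s (t - s) by exact: diff_derivable.
rewrite -lerBlDl.
have -> : derive1 phi s * (t - s) = 'D_(t - s) phi s.
  rewrite derive1E !deriveE// -[t - s in RHS]mulr1 -[(t - s) * 1]/((t - s) *: 1).
  by rewrite linearZ/= mulrC.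
(* Concavity bounds the difference quotient below by [phi t - phi s] for [0 < h <= 1], so the
   derivative is taken as a limit from the right. *)
have : h^-1 *: ((phi \o shift s) (h *: (t - s)) - phi s) @[h --> 0^'+]
   --> 'D_(t - s) phi s.
  apply: cvg_trans dts; apply: cvg_app; apply: within_subset.
  by move=> h; exact: lt0r_neq0.
move=> cvgD; rewrite -(cvg_lim _ cvgD)//; apply: limr_ge.
  exact: (cvgP _ cvgD).
near=> h.
have h0 : 0 < h by near: h; exact: nbhs_right_gt.
have h1 : h <= 1 by near: h; exact: nbhs_right_le.
rewrite [leRHS]/(h^-1 * (phi (h * (t - s) + s) - phi s)) ler_pdivlMl//.
have Ds' : (s : R^o) \in D by exact: mem_set.
have Dt' : (t : R^o) \in D by exact: mem_set.
have cvx : - phi (h * (t - s) + s) <= h * - phi t + (1 - h) * - phi s.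
  rewrite (_ : h * (t - s) + s = h * t + (1 - h) * s); last by ring.
  exact: (cvxD (Itv01 (ltW h0) h1) t s Dt' Ds').
by rewrite -[X in _ <= X - _]/(phi (h * (t - s) + s)); lra.
Unshelve. all: by end_near. Qed.

(** In use [p], [g], [f] are phi'(r_n), ||grad F(z_n)||, phi(r_n), and primes mark index n+1. AM-GM
    with weight 1/3 on [d' + d] gives 2 d' <= d + (9/4) q, the form that telescopes; 9/4 is 1 / (4
    (1/3)^2). *)
Lemma kl_step (R : realType) (a b p g d d' r r' f f' : R) :
  0 < a -> 0 < b -> 0 <= d -> 0 <= d' -> 0 < p ->
  a * d' ^+ 2 <= r - r' -> g <= b * (d' + d) -> 1 <= p * g ->
  p * (r - r') <= f - f' ->
  d' <= d + 9 / 4 * (b / a) * f - (d' + 9 / 4 * (b / a) * f').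
Proof.
move=> a0 b0 d0 d'0 p0 ad gb pg prf.
set q := b / a * (f - f').
have pd0 : 0 <= p * (a * d' ^+ 2).
  by rewrite mulr_ge0 ?(ltW p0)// mulr_ge0 ?sqr_ge0// ltW.
have pad : p * (a * d' ^+ 2) <= f - f' by rewrite (le_trans _ prf)// ler_pM2l.
have q0 : 0 <= q by rewrite mulr_ge0 ?divr_ge0 ?(ltW a0) ?(ltW b0)// (le_trans pd0).
have dq : d' ^+ 2 <= q * (d' + d).
  rewrite -(ler_pM2l a0).
  have -> : a * (q * (d' + d)) = (f - f') * (b * (d' + d)).
    by rewrite /q; field; rewrite gt_eqF.
  (* Inserting this factor, at least 1, lets [pad] absorb [p]; derivative and gradient both
     disappear. *)
  have bd : 1 <= p * (b * (d' + d)) by rewrite (le_trans pg)// ler_pM2l.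
  apply: (@le_trans _ _ ((a * d' ^+ 2) * (p * (b * (d' + d))))).
    by rewrite ler_peMr// mulr_ge0 ?sqr_ge0// ltW.
  by rewrite mulrCA mulrA ler_wpM2r// mulr_ge0 ?(ltW b0)// addr_ge0.
(* 9 d'^2 <= 4 (9/4 q) (d' + d) <= (d' + d + 9/4 q)^2, by AM-GM. *)
suff : 2 * d' <= d + 9 / 4 * q by rewrite /q; lra.
rewrite leNgt; apply/negP => dlt.
have lt2 : (d' + d + 9 / 4 * q) ^+ 2 < (3 * d') ^+ 2.
  by rewrite ltr_pXn2r ?nnegrE//; lra.
have sq := sqr_ge0 (d' + d - 9 / 4 * q).
clearbody q; nra.
Qed.

(** * Trapping, and passage from a subsequence to the whole sequence *)

Lemma trapped_in_ball (R : realType) (V : normedModType R) (x : nat -> V) (y : V)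
    (T : nat -> R) (rho : R) (N : nat) :
  (forall n, (N <= n)%N -> `|y - x n| + T n < rho ->
     `|x n.+1 - x n| <= T n - T n.+1) ->
  `|y - x N| + T N < rho ->
  forall n, (N <= n)%N -> `|y - x n| + T n < rho.
Proof.
move=> step VN n; elim: n => [|n IH]; first by rewrite leqn0 => /eqP <-.
rewrite leq_eqVlt => /predU1P[<-//|]; rewrite ltnS => Nn.
(* The invariant at [n] licenses the step bound; the drop of [T] then pays for the distance moved,
   so the invariant persists. *)
have Vn := IH Nn; have xn := step _ Nn Vn.
have -> : y - x n.+1 = (y - x n) - (x n.+1 - x n).
  by rewrite opprB addrA addrNK.
have := ler_normB (y - x n) (x n.+1 - x n); lra.
Qed.

Lemma leq_extraction (k : nat -> nat) (n : nat) :
  {homo k : i j / (i < j)%N} -> (n <= k n)%N.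
Proof.
by move=> kincr; elim: n => // n IH; apply: leq_ltn_trans IH (kincr _ _ _).
Qed.

Lemma cvg_extraction (k : nat -> nat) :
  {homo k : i j / (i < j)%N} -> k @ \oo --> \oo.
Proof.
move=> kincr A [N _ NA]; exists N => // n Nn; apply: NA.
exact: leq_trans Nn (leq_extraction n kincr).
Qed.

(** By monotonicity a single index [k j] controls the whole tail, and [k] overtakes every index,
    whence the lower bound. *)
Lemma nonincreasing_extraction_cvg (R : realType) (r : nat -> R)
    (k : nat -> nat) (l : R) :
  (forall n, r n.+1 <= r n) -> {homo k : i j / (i < j)%N} ->
  r (k j) @[j --> \oo] --> l -> (forall n, l <= r n) /\ r @ \oo --> l.
Proof.
move=> rS kincr rkl.
have ni : {homo r : n p / (n <= p)%N >-> p <= n}.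
  by apply/nonincreasing_seqP.
have lr n : l <= r n.
  rewrite -(cvg_lim _ rkl)//; apply: limr_le; first exact: (cvgP _ rkl).
  exists n => // j nj; apply: ni; exact: leq_trans nj (leq_extraction j kincr).
split=> //; apply/cvgrPdistC_lt => e e0.
have /cvgrPdistC_lt/(_ e e0)[j _ /(_ j (leqnn j))/= rkj] := rkl.
exists (k j) => // n kjn; rewrite ger0_norm ?subr_ge0//.
by apply: le_lt_trans rkj; rewrite ger0_norm ?subr_ge0// lerB// ni.
Qed.

Lemma trapped_cvg (R : realType) (V : normedModType R) (x : nat -> V) (y : V)
    (T : nat -> R) (k : nat -> nat) (rho : R) :
  0 < rho -> (\forall n \near \oo, 0 <= T n) ->
  (\forall n \near \oo, `|y - x n| < rho ->
     `|x n.+1 - x n| <= T n - T n.+1) ->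
  {homo k : i j / (i < j)%N} ->
  x (k j) @[j --> \oo] --> y -> T (k j) @[j --> \oo] --> 0 ->
  x @ \oo --> y.
Proof.
move=> rho0 T0 step kincr xky Tk0; apply/cvgrPdist_lt => e e0.
(* Below [e] for convergence, below [rho] so that the step bound stays available inside the trap. *)
pose e' := Num.min e rho.
have e'0 : 0 < e' by rewrite lt_min e0.
have [N0 _ N0P] := filterI T0 step.
have Vk : `|y - x (k j)| + T (k j) @[j --> \oo] --> 0.
  rewrite -[X in _ --> X]addr0; apply: cvgD => //.
  rewrite -(normr0 V) -(subrr y); apply: cvg_norm; apply: cvgB => //.
  exact: cvg_cst.
have small := cvgr_lt _ Vk _ e'0.
have [j [kj Vj]] : exists j, (N0 <= k j)%N /\ `|y - x (k j)| + T (k j) < e'.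
  have [j0 _ j0P] := small; exists (maxn j0 N0).
  split; last by apply: j0P; exact: leq_maxl.
  exact: leq_trans (leq_maxr _ _) (leq_extraction _ kincr).
exists (k j) => // n kjn /=.
have lte' p : (k j <= p)%N -> `|y - x p| + T p < e' -> `|y - x p| < e'.
  move=> kjp; apply: le_lt_trans; rewrite lerDl.
  by have [] := N0P p (leq_trans kj kjp).
have : `|y - x n| < e'.
  apply: (lte' n) => //; apply: (@trapped_in_ball _ _ _ _ _ _ (k j)) => // p kjp Vp.
  have [_] := N0P p (leq_trans kj kjp); apply.
  by apply: lt_le_trans (lte' p kjp Vp) _; rewrite ge_min lexx orbT.
by move=> /lt_le_trans; apply; rewrite ge_min lexx.
Qed.

(** * Distances of z_n and of x_n to the limit differ by at most A d_n *)

Lemma norm_sub_row_mx_le (R : realType) m (u v w : 'rV[R]_m) (a b A : R) :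
  `|a| <= A -> `|b| <= A ->
  `|row_mx u u - row_mx (v + a *: w) (v + b *: w)| <= `|u - v| + A * enorm w.
Proof.
move=> aA bA; rewrite opp_row_mx add_row_mx; apply: norm_row_mx_le;
  rewrite opprD addrA (le_trans (ler_normB _ _))// lerD2l normrZ;
  by rewrite ler_pM// norm_le_enorm.
Qed.

Lemma norm_sub_le_row_mx (R : realType) m (u v w : 'rV[R]_m) (a b A : R) :
  `|a| <= A ->
  `|u - v| <= `|row_mx u u - row_mx (v + a *: w) (v + b *: w)| + A * enorm w.
Proof.
move=> aA.
have -> : u - v = (u - (v + a *: w)) + a *: w.
  by rewrite opprD addrA addrNK.
apply: (le_trans (ler_normD _ _)); apply: lerD; last first.
  by rewrite normrZ ler_pM// norm_le_enorm.
rewrite opp_row_mx add_row_mx.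
by have := norm_lsubmx_le (row_mx (u - (v + a *: w)) (u - (v + b *: w)));
  rewrite row_mxKl.
Qed.

Lemma bounded_fun_bound (R : realType) (u : nat -> R) :
  bounded_fun u -> exists A, forall n, `|u n| <= A.
Proof.
move=> [M [_ uM]]; exists (M + 1) => n.
by apply: (uM (M + 1)) => //; rewrite ltrDl.
Qed.

(** Continuity of [phi] at 0 is relative to [0, eta), so the limits compose once [r] eventually
    stays in that interval. *)
Lemma Theta_cvg0 (R : realType) (eta : \bar R) (phi : R -> R) (r : nat -> R) :
  (0 < eta)%E -> Theta eta phi ->
  (\forall n \near \oo, 0 <= r n /\ ((r n)%:E < eta)%E) ->
  r @ \oo --> 0 -> phi (r n) @[n --> \oo] --> 0.
Proof.
move=> eta0 [_ _ /subspace_continuousP phic phi0 _] rD r0.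
have {}phic : phi t @[t --> within [set t : R | 0 <= t /\ (t%:E < eta)%E]
    (nbhs 0)] --> 0.
  by rewrite -[X in _ --> X]phi0; exact: phic.
apply: cvg_comp phic.
by move=> A /r0 rA; apply: filterS2 rD rA => n Dn; apply.
Qed.

Lemma near_lt_ereal (R : realType) (eta : \bar R) (r : nat -> R) :
  (0 < eta)%E -> r @ \oo --> 0 -> \forall n \near \oo, ((r n)%:E < eta)%E.
Proof.
case: eta => [e| |]; rewrite ?lte_fin// => e0 r0.
- by apply: filterS (cvgr_lt _ r0 _ e0) => n; rewrite lte_fin.
- by apply: nearW => n; exact: ltry.
Qed.

Lemma descent_cvg0 (R : realType) (a : R) (d r : nat -> R) :
  0 < a -> (forall n, 0 <= r n) -> (forall n, a * d n.+1 ^+ 2 <= r n - r n.+1) ->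
  r @ \oo --> 0 -> d @ \oo --> 0.
Proof.
move=> a0 r_ge0 desc r0; rewrite -cvg_shiftS; apply/cvgr0Pnorm_lt => e e0.
have ae0 : 0 < a * e ^+ 2 by rewrite mulr_gt0 ?exprn_gt0.
apply: filterS (cvgr_lt _ r0 _ ae0) => n rn /=.
rewrite -ltr_sqr ?nnegrE ?(ltW e0)// real_normK ?num_real// -(ltr_pM2l a0).
by apply: le_lt_trans rn; have := desc n; have := r_ge0 n.+1; lra.
Qed.

Theorem theorem6 (R : realType) (m : nat) (F : 'rV[R]_(m + m) -> R)
    (x : nat -> 'rV[R]_m) (xm1 : 'rV[R]_m) (alpha beta : nat -> R)
    (a b : R) (xs : 'rV[R]_m)
    (F_C1 : continuously_differentiable F)
    (alpha_bounded : bounded_fun alpha)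
    (beta_bounded : bounded_fun beta)
    (a_gt0 : 0 < a) (b_gt0 : 0 < b)
    (H1 : forall n : nat,
      a * enorm (x n.+1 - x n) ^+ 2 <=
      F (zseq xm1 x alpha beta n) - F (zseq xm1 x alpha beta n.+1))
    (H2 : forall n : nat, (1 <= n)%N ->
      enorm (gradient F (zseq xm1 x alpha beta n)) <=
      b * (enorm (x n.+1 - x n) + enorm (x n - x n.-1)))
    (omega_nonempty : cluster_points (zseq xm1 x alpha beta) !=set0)
    (zs_omega : cluster_points (zseq xm1 x alpha beta) (row_mx xs xs))
    (F_KL : KL_property F (row_mx xs xs)) :
  [/\ x @ \oo --> xs,
      zseq xm1 x alpha beta @ \oo --> row_mx xs xs &
      gradient F (row_mx xs xs) = 0].
Proof.
have [[dF gradFc] [k [kincr zk]]] := (F_C1, zs_omega).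
set z := zseq xm1 x alpha beta in H1 H2 zk *.
set zs := row_mx xs xs in zk F_KL *.
pose d n := enorm (x n - previous xm1 x n).
pose r n := F (z n) - F zs.
have d_ge0 n : 0 <= d n by exact: sqrtr_ge0.
have [A [alphaA betaA]] : exists A, (forall n, `|alpha n| <= A) /\
    (forall n, `|beta n| <= A).
  have [[A1 alphaA] [A2 betaA]] :=
    (bounded_fun_bound alpha_bounded, bounded_fun_bound beta_bounded).
  by exists (Num.max A1 A2); split=> n; rewrite le_max ?alphaA// betaA orbT.
have A_ge0 : 0 <= A by rewrite (le_trans _ (alphaA 0%N)).
have desc n : a * d n.+1 ^+ 2 <= r n - r n.+1.
  by rewrite (le_trans (H1 n))// /r opprB addrA addrNK.
have rk0 : r (k j) @[j --> \oo] --> 0.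
  rewrite -(subrr (F zs)); apply: cvgB; last exact: cvg_cst.
  exact: (cvg_comp _ _ zk (differentiable_continuous (dF zs))).
have [r_ge0 r0] : (forall n, 0 <= r n) /\ r @ \oo --> 0.
  apply: nonincreasing_extraction_cvg kincr rk0 => n.
  rewrite -subr_ge0 (le_trans _ (desc n))// mulr_ge0 ?sqr_ge0//.
  exact: ltW.
have d0 : d @ \oo --> 0 by exact: descent_cvg0 a_gt0 r_ge0 desc r0.
have Ad0 : A * d n @[n --> \oo] --> 0.
  by rewrite -(mulr0 A); apply: cvgMl_tmp.
have Adk0 := cvg_comp _ _ (cvg_extraction kincr) Ad0.
have zx n : `|zs - z n| <= `|xs - x n| + A * d n.
  exact: norm_sub_row_mx_le.
have xz n : `|xs - x n| <= `|zs - z n| + A * d n.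
  exact: norm_sub_le_row_mx.
(* The subsequence is given for z; as A d_n tends to 0, it serves for x too. *)
have xk : x (k j) @[j --> \oo] --> xs.
  apply/cvgrPdist_lt => e e0.
  have e20 : 0 < e / 2 by rewrite divr_gt0.
  move/cvgrPdist_lt : zk => /(_ _ e20) zk.
  near=> j.
  rewrite (le_lt_trans (xz _))// (splitr e) ltrD//; near: j => //.
  exact: (cvgr_lt _ Adk0).
have [eta [U [phi [eta0 zsU phiT KL]]]] := F_KL.
have r_lt_eta := near_lt_ereal eta0 r0.
have rD : \forall n \near \oo, 0 <= r n /\ ((r n)%:E < eta)%E.
  by apply: filterS r_lt_eta => n; split.
have phir0 := Theta_cvg0 eta0 phiT rD r0.
have [phi_ge0 phi_concave _ phi0 [dphi _ dphi_gt0]] := phiT.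
pose C := 9 / 4 * (b / a).
pose T n := d n + C * phi (r n).
have [e e0 eU] : exists2 e, 0 < e & forall w, `|zs - w| < e -> U w.
  by move/nbhs_normP : zsU => [e e0 eU]; exists e => // w wU; exact: eU.
have C_ge0 : 0 <= C by rewrite !mulr_ge0 ?invr_ge0 ?ltW.
have T_ge0 : \forall n \near \oo, 0 <= T n.
  apply: filterS rD => n rDn; rewrite addr_ge0// mulr_ge0//.
  exact: phi_ge0.
have T0 : T @ \oo --> 0.
  rewrite -[0](addr0 0) -[in X in _ --> _ + X](mulr0 C).
  by apply: cvgD => //; apply: cvgMl_tmp.
(* For n >= 1, [previous xm1 x n] computes to [x n.-1], which puts (H2) in terms of [d]. *)
have grad_le n : (0 < n)%N ->
    enorm (gradient F (z n)) <= b * (d n.+1 + d n).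
  by case: n => // n _; exact: (H2 n.+1 isT).
(* The other half of the radius [e] is left for A d_n, so that z_n lies in [U]. *)
have step : \forall n \near \oo, `|xs - x n| < e / 2 ->
    `|x n.+1 - x n| <= T n - T n.+1.
  near=> n => xn.
  have n1 : (0 < n)%N by near: n; exact: nbhs_infty_gt.
  have Adn : A * d n < e / 2.
    by near: n; apply: (cvgr_lt _ Ad0); rewrite divr_gt0.
  have Un : U (z n).
    by apply: eU; rewrite (le_lt_trans (zx n))// (splitr e) ltrD.
  apply: le_trans (norm_le_enorm _) _; rewrite -/(d n.+1).
  have rDn : 0 <= r n /\ ((r n)%:E < eta)%E by near: n.
  have rDSn : 0 <= r n.+1 /\ ((r n.+1)%:E < eta)%E.
    by near: n; exact: (@cvg_extraction S _ _ rD).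
  (* The KL inequality requires F(z_n) > F(zs) strictly. If r_n = 0, descent forces r_{n+1} =
     d_{n+1} = 0 and the claim reduces to 0 <= d_n. *)
  have [rn0|rn0] := eqVneq (r n) 0.
    have ad_ge0 : 0 <= a * d n.+1 ^+ 2 by rewrite mulr_ge0 ?sqr_ge0 ?ltW.
    have [descn rSn_ge0] := (desc n, r_ge0 n.+1).
    have rSn0 : r n.+1 = 0 by lra.
    have dSn0 : d n.+1 = 0.
      have : a * d n.+1 ^+ 2 == 0 by apply/eqP; lra.
      by rewrite mulf_eq0 gt_eqF//= sqrf_eq0 => /eqP.
    by rewrite /T dSn0 rn0 rSn0; have := d_ge0 n; lra.
  have rn_gt0 : 0 < r n by rewrite lt_neqAle eq_sym rn0 r_ge0.
  have Dn := conj rn_gt0 rDn.2.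
  apply: (kl_step a_gt0 b_gt0 (d_ge0 n) (d_ge0 n.+1) (dphi_gt0 _ Dn) (desc n)).
  - exact: grad_le.
  - apply: KL => //; first by rewrite -subr_gt0.
    by rewrite -lteBlDl//; exact: Dn.2.
  (* The tangent at r_n, evaluated at r_{n+1}, bounds phi'(r_n) (r_n - r_{n+1}) by the drop of
     [phi]. *)
  - have := concave_le_tangent phi_concave rDn rDSn (dphi _ Dn); lra.
have x_cvg : x @ \oo --> xs.
  have Tk0 := cvg_comp _ _ (cvg_extraction kincr) T0.
  by apply: trapped_cvg step kincr xk Tk0 => //; rewrite divr_gt0.
have z_cvg : z @ \oo --> zs.
  apply/cvgrPdist_lt => c c0; near=> n.
  rewrite (le_lt_trans (zx n))// (splitr c) ltrD//; near: n.
    by move/cvgrPdist_lt : x_cvg; apply; rewrite divr_gt0.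
  by apply: (cvgr_lt _ Ad0); rewrite divr_gt0.
split=> //.
(* The gradients along z have two limits to be identified: [gradient F zs] by continuity, and 0 by
   (H2) since d_n tends to 0. *)
have gradz : gradient F (z n) @[n --> \oo] --> gradient F zs.
  exact: (cvg_comp _ _ z_cvg (gradFc zs)).
have : b * (d n.+1 + d n) @[n --> \oo] --> b * (0 + 0).
  by apply: cvgMl_tmp; apply: cvgD => //; rewrite cvg_shiftS.
rewrite addr0 mulr0 => bd0.
have gradz0 : gradient F (z n) @[n --> \oo] --> (0 : 'rV[R]_(m + m)).
  apply/cvgr0Pnorm_lt => c c0; near=> n.
  apply: le_lt_trans (norm_le_enorm _) _; apply: le_lt_trans (grad_le n _) _.
    by near: n; exact: nbhs_infty_gt.
  by near: n; exact: (cvgr_lt _ bd0).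
by apply: cvg_unique gradz gradz0; exact: norm_hausdorff.
Unshelve. all: by end_near. Qed.
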